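(* Let $N\ge2$, $k\in\,]0,\infty[$, $z\in\mathbb A_N$, and consider the diffusion $(\widetilde Z_{t,k})_{t\ge0}$ on $\mathbb A_N$ with start in $z$. Then, for $l=0,1,\ldots,N$, the process $$\bigl(e^{l(1/k+N-l)t}\,e_l(\widetilde Z_{t,k})\bigr)_{t\ge0}$$ is a martingale with respect to the canonical filtration. In particular, for $t\ge0$, $$\mathbb E\bigl(e_l(\widetilde Z_{t,k})\bigr)=e^{-l(1/k+N-l)t}\,e_l(z).$$
   Context: $e_l$ is the $l$-th elementary symmetric polynomial in $N$ variables. $C_N=\{x\in\mathbb R^N:\ x_1\le x_2\le\ldots\le x_N\le x_1+2\pi\}$ is a fundamental domain of the affine Weyl group $W_{\mathit{aff}}=S_N\ltimes2\pi Q^\vee$, $Q^\vee=\{m\in\mathbb Z^N:\sum_jm_j=0\}$. With $e^{ix}:=(e^{ix_1},\ldots,e^{ix_N})$, put $\mathbb A_N=\{e^{ix}:x\in C_N\}\subset\mathbb T^N$, where $\mathbb T$ is the complex unit circle. For $k\in\,]0,\infty[$, $\widetilde X_k=(\widetilde X_{t,k})_{t\ge0}$ is the Feller diffusion on $C_N$ with continuous paths, reflected at the boundary of $C_N$, with generator $$\widetilde L_k=\frac1k\Delta+\sum_{j=1}^N\sum_{l\ne j}\cot\Bigl(\frac{x_j-x_l}2\Bigr)\frac{\partial}{\partial x_j}$$ acting on restrictions to $C_N$ of $W_{\mathit{aff}}$-invariant functions in $C^2(\mathbb R^N)$. Equivalently, it is the $C_N$-valued continuous solution of the SDE $$d\widetilde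 X_{t,k,j}=\frac{\sqrt2}{\sqrt k}\,dB_{t,j}+\sum_{l\ne j}\cot\Bigl(\frac{\widetilde X_{t,k,j}-\widetilde X_{t,k,l}}2\Bigr)dt\qquad(j=1,\ldots,N)$$ with an $N$-dimensional Brownian motion $(B_{t,1},\ldots,B_{t,N})_{t\ge0}$. Then $\widetilde Z_{t,k}:=e^{i\widetilde X_{t,k}}$; start in $z$ means that $\widetilde X_{0,k}=x$ for a deterministic $x\in C_N$ with $e^{ix}=z$. *)

(* Defs.v *)
From HB Require Import structures.
From mathcomp Require Import all_boot all_order all_algebra.
From mathcomp Require Import all_fingroup.
From mathcomp Require Import all_classical all_reals all_analysis.
From mathcomp Require Import complex.
From mathcomp.multinomials Require mpoly.

Set Implicit Arguments.
Unset Strict Implicit.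
Unset Printing Implicit Defensive.

Import Order.TTheory GRing.Theory Num.Theory.
Import numFieldNormedType.Exports.

Local Open Scope classical_set_scope.
Local Open Scope complex_scope.
Local Open Scope ring_scope.

(* Processes are indexed by all of [R]; only times [t >= 0] are ever used. *)

Section filtrations_martingales.
Context {d : measure_display} {T : measurableType d} {R : realType}.

(* sigma(Y_s : 0 <= s <= t), for the Borel sigma-algebra on the state space. *)
Definition natural_filtration (S : topologicalType) (Y : R -> T -> S) (t : R)
    : set (set T) :=
  <<s [set A | exists s U, [/\ 0 <= s <= t, open U & A = Y s @^-1` U]] >>.

Definition cintegral (P : probability T R) (A : set T) (f : T -> R[i]) : R[i] :=
  \int[P]_(w in A) complex.Re (f w) +i* \int[P]_(w in A) complex.Im (f w).

Definition cintegrable (P : probability T R) (f : T -> R[i]) : Prop :=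
  P.-integrable setT (fun w => (complex.Re (f w))%:E) /\
  P.-integrable setT (fun w => (complex.Im (f w))%:E).

(* The last clause says E[M_t | F_s] = M_s. The cast to [numFieldType] is what
   gives [R[i]] its usual topology. *)
Definition martingale (P : probability T R) (F : R -> set (set T))
    (M : R -> T -> R[i]) : Prop :=
  [/\ forall t (U : set (R[i] : numFieldType)), 0 <= t -> open U ->
        F t (M t @^-1` U),
      forall t, 0 <= t -> cintegrable P (M t)
    & forall s t A, 0 <= s -> s <= t -> F s A ->
        cintegral P A (M t) = cintegral P A (M s)].

End filtrations_martingales.

(* Feller semigroups on a closed subset [E] of a topological space [V]. A
   function on [E] is represented by any function on [V]; only its values on
   [E] matter. *)
Section feller.
Context {R : realType} {V : topologicalType}.
Implicit Types (E : set V) (f g : V -> R) (Q : R -> (V -> R) -> V -> R).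

Definition C0 E f : Prop :=
  {within E, continuous f} /\
  forall e, 0 < e -> exists K, [/\ compact K, K `<=` E
    & forall x, E x -> ~ K x -> `|f x| < e].

Record feller_semigroup E Q : Prop := {
  feller_C0 : forall t f, 0 <= t -> C0 E f -> C0 E (Q t f);
  feller_linear : forall t a f g x, 0 <= t -> C0 E f -> C0 E g -> E x ->
    Q t (fun y => a * f y + g y) x = a * Q t f x + Q t g x;
  feller_ge0 : forall t f, 0 <= t -> C0 E f -> (forall x, E x -> 0 <= f x) ->
    forall x, E x -> 0 <= Q t f x;
  feller_contraction : forall t f c, 0 <= t -> C0 E f ->
    (forall x, E x -> `|f x| <= c) -> forall x, E x -> `|Q t f x| <= c;
  feller0 : forall f x, C0 E f -> E x -> Q 0 f x = f x;
  fellerD : forall s t f x, 0 <= s -> 0 <= t -> C0 E f -> E x ->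
    Q (s + t) f x = Q s (Q t f) x;
  feller_continuous : forall f e, C0 E f -> 0 < e ->
    \forall h \near 0^'+, forall x, E x -> `|Q h f x - f x| <= e
}.

(* [f] is in the domain of the infinitesimal generator, which maps it to [g]. *)
Definition generator E Q f g : Prop :=
  [/\ C0 E f, C0 E g
    & forall e, 0 < e ->
      \forall h \near 0^'+, forall x, E x ->
        `|(Q h f x - f x) / h - g x| <= e].

(* Markov process with values in [E], continuous paths and semigroup [Q]:
   E[f(X_(s+t)) | X_u, u <= s] = (Q_t f)(X_s). *)
Record feller_process {d : measure_display} {T : measurableType d}
    (P : probability T R) E Q (X : R -> T -> V) : Prop := {
  process_semigroup : feller_semigroup E Q;
  process_measurable : forall t U, 0 <= t -> open U -> measurable (X t @^-1` U);
  process_range : forall t w, 0 <= t -> E (X t w);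
  process_continuous : forall w, {within [set t | 0 <= t], continuous (X^~ w)};
  process_markov : forall s t f A, 0 <= s -> 0 <= t -> C0 E f ->
    natural_filtration X s A ->
    \int[P]_(w in A) f (X (s + t) w) = \int[P]_(w in A) Q t f (X s w)
}.

End feller.

Section diffusion.
Context {R : realType} {N : nat}.
Implicit Types (f : 'rV[R]_N -> R) (x : 'rV[R]_N) (k : R).

(* C_N: for i <= j the chain x_1 <= ... <= x_N <= x_1 + 2 pi gives
   x_i <= x_j <= x_i + 2 pi; conversely take consecutive indices and (1, N). *)
Definition chamber : set 'rV[R]_N :=
  [set x | forall i j : 'I_N, (i <= j)%N ->
    x 0 i <= x 0 j <= x 0 i + 2 * pi].

Definition open_chamber : set 'rV[R]_N :=
  [set x | forall i j : 'I_N, (i < j)%N ->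
    x 0 i < x 0 j < x 0 i + 2 * pi].

(* Invariance under S_N |x 2 pi Q^vee. *)
Definition affine_weyl_invariant f : Prop :=
  forall (s : 'S_N) (m : 'I_N -> int) x, \sum_j m j = 0 ->
    f (col_perm s x + \row_j (2 * pi * (m j)%:~R)) = f x.

Definition partial (j : 'I_N) f x : R := 'D_(delta_mx 0 j) f x.

Definition C2 f : Prop :=
  [/\ continuous f,
      forall j x, derivable f x (delta_mx 0 j),
      forall j, continuous (partial j f),
      forall i j x, derivable (partial j f) x (delta_mx 0 i)
    & forall i j, continuous (partial i (partial j f))].

Definition cot (u : R) : R := cos u / sin u.

Definition Lop k f x : R :=
  k^-1 * (\sum_j partial j (partial j f) x) +
  \sum_(j < N) \sum_(l < N | l != j) cot ((x 0 j - x 0 l) / 2) * partial j f x.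

(* The Feller diffusion on C_N reflected at the boundary. [C_N] is not compact,
   so the invariant C^2 functions to which the generator on [C0 C_N] applies are
   taken with compact support in C_N. [Lop] is singular on the boundary, where
   [Lop k f] is to be read as its continuous extension from the interior: this
   is the continuous function [g]. Reflection is encoded by letting [f] range
   over all invariant functions, without further boundary condition. *)
Definition reflected_diffusion {d : measure_display} {T : measurableType d}
    (P : probability T R) k (X : R -> T -> 'rV[R]_N) : Prop :=
  exists Q : R -> ('rV[R]_N -> R) -> 'rV[R]_N -> R,
    feller_process P chamber Q X /\
    forall f, C2 f -> affine_weyl_invariant f ->
      (exists K, compact K /\ forall x, chamber x -> ~ K x -> f x = 0) ->
      exists2 g, generator chamber Q f g
        & forall x, open_chamber x -> g x = Lop k f x.

(* x |-> (e^(i x_1), ..., e^(i x_N)) *)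
Definition expi x : 'rV[R[i]]_N := \row_j (cos (x 0 j) +i* sin (x 0 j)).

Definition torus_chamber : set 'rV[R[i]]_N := expi @` chamber.

Definition elem_sym (l : nat) (z : 'rV[R[i]]_N) : R[i] :=
  mpoly.meval (z 0) (mpoly.mesym N R[i] l).

Definition torus_process {T : Type} (X : R -> T -> 'rV[R]_N) (t : R) (w : T)
    : 'rV[R[i]]_N := expi (X t w).

Definition starts_in {T : Type} (X : R -> T -> 'rV[R]_N) (z : 'rV[R[i]]_N)
    : Prop :=
  exists x, [/\ chamber x, expi x = z & forall w, X 0 w = x].

(* sigma(Z_s : 0 <= s <= t). As X is a continuous lift of Z through
   R^N -> T^N with a deterministic start, it equals sigma(X_s : 0 <= s <= t). *)
Definition torus_filtration {d : measure_display} {T : measurableType d}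
    (X : R -> T -> 'rV[R]_N) : R -> set (set T) :=
  @natural_filtration d T R 'rV[(R[i] : numFieldType)]_N (torus_process X).

End diffusion.

(* Main.v *)
(* The function e_l(e^(ix)) is an eigenfunction of the generator, with eigenvalue
   -l(1/k + N - l): in the drift, the monomials exchanged by the transposition
   (j m) combine into multiples of sin((x_j - x_m)/2), which cancel the
   singularity of cot((x_j - x_m)/2). It is not in C_0 of the noncompact chamber,
   so it is damped by a C^2 bump in c (x_1 + ... + x_N); this sum is invariant
   under the affine Weyl group and not affected by the drift, and the error made
   in the eigenvalue equation is O(c), uniformly. Contractivity of the semigroup
   turns this into an O(c) error in Q_t f = e^(-lambda t) f, and c -> 0 gives the
   martingale property. *)
Require Import Defs.
From HB Require Import structures.
From mathcomp Require Import all_boot all_order all_algebra.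
From mathcomp Require Import all_fingroup.
From mathcomp Require Import all_classical all_reals all_analysis.
From mathcomp Require Import measurable_realfun.
From mathcomp Require Import complex.
From mathcomp.multinomials Require mpoly.
From mathcomp Require Import ring lra.
Set Implicit Arguments.
Unset Strict Implicit.
Unset Printing Implicit Defensive.
Import Order.TTheory GRing.Theory Num.Theory.
Import numFieldNormedType.Exports.
Local Open Scope classical_set_scope.
Local Open Scope complex_scope.
Local Open Scope ring_scope.

(** * Semigroup estimates for approximate eigenfunctions of the generator *)

Section feller_decay.
Context {R : realType} {V : topologicalType}.
Implicit Types (E : set V) (f g : V -> R) (Q : R -> (V -> R) -> V -> R).

Lemma C0_axpy E a f g : C0 E f -> C0 E g -> C0 E (fun y => a * f y + g y).
Proof.
move=> [cf vf] [cg vg]; split.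
  move=> x; apply: cvgD; last exact: cg.
  by apply: cvgM; [exact: cvg_cst | exact: cf].
move=> e e0.
have d0 : 0 < e / (2 * (`|a| + 1)) by apply: divr_gt0 => //; rewrite mulr_gt0// ltr_wpDl.
have [K [cK KE vK]] := vf _ d0.
have e20 : 0 < e / 2 by rewrite divr_gt0.
have [L [cL LE vL]] := vg _ e20.
exists (K `|` L); split.
- exact: compactU.
- by move=> x [/KE|/LE].
move=> x Ex /not_orP[nK nL].
apply: (le_lt_trans (ler_normD _ _)); rewrite normrM.
have h1 := vK _ Ex nK; have h2 := vL _ Ex nL.
have : `|a| * `|f x| <= e / 2.
  apply: (@le_trans _ _ ((`|a| + 1) * (e / (2 * (`|a| + 1))))).
    by apply: ler_pM => //; [rewrite lerDl | exact: ltW].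
  have A0 : `|a| + 1 != 0 by rewrite gt_eqF// ltr_wpDl.
  by rewrite le_eqVlt; apply/orP; left; apply/eqP; field.
lra.
Qed.

(** Both sides come from [1 + u <= expR u]: at [u = - y] for the lower bound and, after inversion,
    at [u = y] for the upper one. *)
Lemma expRN_approx (y : R) : 0 <= y -> `|expR (- y) - (1 - y)| <= y ^+ 2.
Proof.
move=> y0.
have h1 := expR_ge1Dx (- y); have h2 := expR_ge1Dx y.
rewrite ger0_norm; last by rewrite subr_ge0.
rewrite expRN.
have : (expR y)^-1 <= (1 + y)^-1 by rewrite lef_pV2// posrE ?expR_gt0//; lra.
have -> : (1 + y)^-1 = 1 - y + y ^+ 2 / (1 + y) by field; rewrite gt_eqF//; lra.
have : y ^+ 2 / (1 + y) <= y ^+ 2.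
  by rewrite ler_pdivrMr; [rewrite ler_peMr// ?sqr_ge0//; lra | lra].
lra.
Qed.

(** Errors add up without amplification: [Q (n%:R * h)] contracts the new error [Q h f - c * f], and
    [|c| <= 1] does not enlarge the old one. *)
Lemma feller_iter E Q f c h eta n : feller_semigroup E Q -> C0 E f ->
  0 <= h -> `|c| <= 1 -> (forall x, E x -> `|Q h f x - c * f x| <= eta) ->
  forall x, E x -> `|Q (n%:R * h) f x - c ^+ n * f x| <= n%:R * eta.
Proof.
move=> FQ Cf h0 c1 Hh; elim: n => [|n IH] x Ex.
  by rewrite !mul0r (feller0 FQ)// expr0 mul1r subrr normr0.
have nh0 : 0 <= n%:R * h by rewrite mulr_ge0.
have CQ := feller_C0 FQ h0 Cf.
rewrite -natr1 [(_ + 1) * h]mulrDl mul1r (fellerD FQ)//.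
have D := feller_linear FQ (- c) nh0 Cf CQ Ex.
have B : `|Q (n%:R * h) (fun y => - c * f y + Q h f y) x| <= eta.
  apply: (feller_contraction FQ) => //; first exact: C0_axpy.
  by move=> y Ey; rewrite addrC mulNr; exact: Hh.
rewrite D in B.
have -> : Q (n%:R * h) (Q h f) x - c ^+ n.+1 * f x =
   (- c * Q (n%:R * h) f x + Q (n%:R * h) (Q h f) x) +
   c * (Q (n%:R * h) f x - c ^+ n * f x) by rewrite exprS; ring.
apply: (le_trans (ler_normD _ _)); rewrite normrM.
have : `|c| * `|Q (n%:R * h) f x - c ^+ n * f x| <= `|Q (n%:R * h) f x - c ^+ n * f x|.
  by rewrite ler_piMl.
have := IH x Ex.
lra.
Qed.

(* The time step [t / n] replaces the derivative of [s => Q s f] along the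
   semigroup: each step costs [o(t / n) + delta * t / n], uniformly on [E]. *)
Lemma feller_decay E Q f g lam delta B : feller_semigroup E Q ->
  generator E Q f g -> 0 <= lam ->
  (forall x, E x -> `|f x| <= B) ->
  (forall x, E x -> `|g x + lam * f x| <= delta) ->
  forall t x, 0 <= t -> E x -> `|Q t f x - expR (- (lam * t)) * f x| <= t * delta.
Proof.
move=> FQ [Cf _ Hg] lam0 fB gd t x t0 Ex.
have B0 : 0 <= B by apply: le_trans (fB _ Ex).
have [->|tN0] := eqVneq t 0.
  by rewrite mulr0 oppr0 expR0 mul1r (feller0 FQ)// subrr normr0 mul0r.
have {tN0}t0' : 0 < t by rewrite lt_def tN0.
apply/ler_addgt0Pr => e e0.
(* Chosen so that the accumulated excess [t * e1 * (1 + lam ^+ 2 * B)] equals [e]. *)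
set e1 := e / (t * (1 + lam ^+ 2 * B)).
have D0 : 0 < t * (1 + lam ^+ 2 * B).
  by rewrite mulr_gt0// ltr_pwDl// mulr_ge0// sqr_ge0.
have e10 : 0 < e1 by apply: divr_gt0.
have step : exists n, (0 < n)%N /\ (t / n%:R <= e1 /\
    forall y, E y -> `|(Q (t / n%:R) f y - f y) / (t / n%:R) - g y| <= e1).
  have [d /= d0 Hd] := Hg _ e10.
  have := near_infty_natSinv_lt (PosNum (divr_gt0 d0 t0')).
  have := near_infty_natSinv_lt (PosNum (divr_gt0 e10 t0')).
  move=> [n1 _ H1] [n2 _ H2].
  exists (maxn n1 n2).+1; split => //.
  have := H1 (maxn n1 n2) (leq_maxl _ _).
  rewrite /= ltr_pdivlMr// mulrC => a1.
  have := H2 (maxn n1 n2) (leq_maxr _ _).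
  rewrite /= ltr_pdivlMr// mulrC => a2.
  split; first exact: ltW.
  apply: Hd => /=; last by rewrite divr_gt0.
  by rewrite sub0r normrN gtr0_norm// divr_gt0.
have [n [n0 [hle Hn]]] := step.
have nR0 : 0 < n%:R :> R by rewrite ltr0n.
set h := t / n%:R in hle Hn.
have h0 : 0 < h by rewrite divr_gt0.
have tE : t = n%:R * h by rewrite /h mulrC divfK// gt_eqF.
clearbody h.
have eE : expR (- (lam * t)) = expR (- (lam * h)) ^+ n.
  by rewrite -expRM_natl tE; congr expR; ring.
have := @feller_iter E Q f (expR (- (lam * h))) h (h * (delta + e1 * (1 + lam ^+ 2 * B))) n
  FQ Cf (ltW h0) _ _ x Ex.
rewrite -eE -tE mulrA -tE => H.
apply: (le_trans (H _ _)).
- by rewrite ger0_norm ?expR_ge0// -expR0 ler_expR oppr_le0 mulr_ge0// ltW.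
- move=> y Ey.
  have := Hn y Ey; have := gd y Ey; have := fB y Ey.
  have lh0 : 0 <= lam * h by rewrite mulr_ge0// ltW.
  have := expRN_approx lh0.
  set u := expR _; set q := Q h f y; set a := f y; set b := g y => h1 h2 h3 h4.
  (* The three terms are the error of the generator quotient, the eigenvalue defect, and the
     second-order error of the exponential. *)
  have -> : q - u * a = h * ((q - a) / h - b) + h * (b + lam * a) - (u - (1 - lam * h)) * a.
    by field; rewrite gt_eqF.
  apply: (le_trans (ler_normB _ _)).
  have k1 : `|h * ((q - a) / h - b) + h * (b + lam * a)| <= h * e1 + h * delta.
    apply: (le_trans (ler_normD _ _)); rewrite !normrM (gtr0_norm h0).
    by apply: lerD; apply: ler_wpM2l => //; exact: ltW.
  have k2 : `|(u - (1 - lam * h)) * a| <= (h * e1) * (lam ^+ 2 * B).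
    rewrite normrM; apply: (@le_trans _ _ ((lam * h) ^+ 2 * B)).
      by apply: ler_pM.
    have -> : (lam * h) ^+ 2 * B = (h * h) * (lam ^+ 2 * B) by ring.
    by apply: ler_wpM2r; rewrite ?mulr_ge0// ?sqr_ge0// ler_pM2l.
  by apply: (le_trans (lerD k1 k2)); rewrite le_eqVlt; apply/orP; left; apply/eqP; ring.
- rewrite mulrDr lerD2l [e1 * _]mulrC mulrA /e1 mulrC divfK//.
  by rewrite gt_eqF.
Qed.

End feller_decay.

(** * A twice differentiable bump function and bounds on its derivatives *)

Section cutoff.
Context {R : realType}.
Implicit Types (u v c s : R).

(** A remainder of at most [h ^+ 2] leaves an error of at most [|h|] in the difference quotient.
    This form handles the kink of [pos_part] by sign cases alone. *)
Lemma is_derive_quadratic_error (f : R -> R) x df :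
  (forall h, `|f (h + x) - f x - h * df| <= h ^+ 2) -> is_derive x 1 f df.
Proof.
move=> H.
have L : h^-1 *: ((f \o shift x) (h *: 1) - f x) @[h --> 0^'] --> df.
  apply/cvgrPdist_le => e e0; near=> h.
  have hN0 : h != 0 by near: h; exact: nbhs_dnbhs_neq.
  have he : `|h| <= e.
    near: h; exists e => //= y; rewrite /= sub0r normrN => ye _; exact: ltW.
  rewrite /= /GRing.scale /= mulr1.
  have -> : df - h^-1 * (f (h + x) - f x) = - (h^-1 * (f (h + x) - f x - h * df)).
    by field.
  rewrite normrN normrM normfV ler_pdivrMl ?normr_gt0//.
  apply: (le_trans (H h)); rewrite -real_normK ?num_real// expr2.
  by rewrite ler_pM2l ?normr_gt0.
apply: DeriveDef; first by apply/cvg_ex; exists df.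
exact: cvg_lim L.
Unshelve. all: by end_near. Qed.

Definition pos_part v := Num.max 0 v.

Lemma pos_partP v : (0 <= v /\ pos_part v = v) \/ (v <= 0 /\ pos_part v = 0).
Proof.
by rewrite /pos_part; have [h|h] := leP 0 v; [left | right; split=> //; exact: ltW].
Qed.

Lemma pos_part_continuous : continuous pos_part.
Proof. by move=> v; apply: continuous_max; [exact: cvg_cst | exact: cvg_id]. Qed.

Lemma is_derive_pos_part2 v :
  is_derive v 1 (fun v => pos_part v ^+ 2) (2 * pos_part v).
Proof.
apply: is_derive_quadratic_error => h; rewrite ler_norml.
have [[a ->]|[a ->]] := pos_partP v;
  have [[b ->]|[b ->]] := pos_partP (h + v); apply/andP; split; nra.
Qed.

Lemma is_derive_pos_part3 v :
  is_derive v 1 (fun v => pos_part v ^+ 3) (3 * pos_part v ^+ 2).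
Proof.
(* With one factor [pos_part v] replaced by [v], the product rule needs only the derivative of the
   square. *)
have -> : (fun v => pos_part v ^+ 3) = id * (fun v => pos_part v ^+ 2).
  apply/funext => w; rewrite !fctE /=.
  by have [[_ ->]|[_ ->]] := pos_partP w; ring.
have H := is_deriveM (is_derive_id v 1) (is_derive_pos_part2 v).
apply: (is_derive_eq H).
rewrite /GRing.scale /=.
by have [[_ ->]|[_ ->]] := pos_partP v; ring.
Qed.

(* A C^2 bump supported in [c * s] in [-1, 1], and its first two derivatives. *)
Definition bump c s := pos_part (1 - (c * s) ^+ 2) ^+ 3.
Definition bump' c s := - 6 * c ^+ 2 * s * pos_part (1 - (c * s) ^+ 2) ^+ 2.
Definition bump'' c s := - 6 * c ^+ 2 * pos_part (1 - (c * s) ^+ 2) ^+ 2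
  + 24 * c ^+ 4 * s ^+ 2 * pos_part (1 - (c * s) ^+ 2).

Lemma is_derive_bump_arg c s :
  is_derive s 1 (fun s => 1 - (c * s) ^+ 2) (- 2 * c ^+ 2 * s).
Proof.
have -> : (fun s => 1 - (c * s) ^+ 2) = cst 1 - (c ^+ 2 *: (id * id)).
  by apply/funext => w; rewrite !fctE /GRing.scale /=; ring.
apply: is_derive_eq.
rewrite /GRing.scale /=; ring.
Qed.

Lemma is_derive_bump c s : is_derive s 1 (bump c) (bump' c s).
Proof.
have H := @is_derive1_comp _ _ _ _ _ _ (is_derive_pos_part3 _) (is_derive_bump_arg c s).
apply: (is_derive_eq H); rewrite /bump'; ring.
Qed.

Lemma is_derive_bump' c s : is_derive s 1 (bump' c) (bump'' c s).
Proof.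
have H := @is_derive1_comp _ _ _ _ _ _ (is_derive_pos_part2 _) (is_derive_bump_arg c s).
have -> : bump' c =
    (- 6 * c ^+ 2) *: (id * ((fun v => pos_part v ^+ 2) \o (fun s => 1 - (c * s) ^+ 2))).
  by apply/funext => w; rewrite !fctE /bump' /GRing.scale /=; ring.
apply: is_derive_eq.
rewrite /bump'' /GRing.scale /=; ring.
Qed.

Lemma bump''_continuous c : continuous (bump'' c).
Proof.
move=> s.
have C : {for s, continuous (fun s => pos_part (1 - (c * s) ^+ 2))}.
  apply: (@continuous_comp _ _ _ (fun s => 1 - (c * s) ^+ 2)); last exact: pos_part_continuous.
  apply: differentiable_continuous; apply/derivable1_diffP.
  by have [] := is_derive_bump_arg c s.
apply: cvgD; apply: cvgM.
- exact: cvg_cst.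
- by rewrite expr2; apply: cvgM.
- by apply: cvgM; [exact: cvg_cst | apply: exprn_continuous].
- exact: C.
Qed.

Lemma bump_continuous c : continuous (bump c).
Proof.
move=> u; apply: differentiable_continuous; apply/derivable1_diffP.
by have [] := is_derive_bump c u.
Qed.

Lemma bump'_continuous c : continuous (bump' c).
Proof.
move=> u; apply: differentiable_continuous; apply/derivable1_diffP.
by have [] := is_derive_bump' c u.
Qed.

Lemma bump_ge0 c s : 0 <= bump c s.
Proof.
by rewrite exprn_ge0//; have [[a ->]|[a ->]] := pos_partP (1 - (c * s) ^+ 2).
Qed.

Lemma pos_part_bump_arg c s : 0 <= pos_part (1 - (c * s) ^+ 2) <= 1.
Proof.
have := sqr_ge0 (c * s).
by have [[a ->]|[a ->]] := pos_partP (1 - (c * s) ^+ 2) => h;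
  apply/andP; split => //; lra.
Qed.

Lemma bump_le1 c s : bump c s <= 1.
Proof. by have /andP[a b] := pos_part_bump_arg c s; rewrite exprn_ile1. Qed.

Lemma bump_eq0 c s : 1 <= `|c * s| -> bump c s = 0.
Proof.
move=> H; rewrite /bump; have [[a ->]|[_ ->]] := pos_partP (1 - (c * s) ^+ 2);
  last by rewrite expr0n.
have : 1 <= (c * s) ^+ 2 by rewrite -real_normK ?num_real// expr_ge1.
move=> b; have -> : 1 - (c * s) ^+ 2 = 0 by lra.
by rewrite expr0n.
Qed.

Lemma bump0_cvg s : bump n.+1%:R^-1 s @[n --> \oo] --> (1 : R).
Proof.
have C : {for 0, continuous (bump^~ s)}.
  (* Since [c * s] is symmetric, [is_derive_bump_arg] with the roles of [c] and [s] swapped gives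
     continuity in [c]. *)
  have -> : bump^~ s = (fun v => v ^+ 3) \o (pos_part \o (fun c => 1 - (s * c) ^+ 2)).
    by apply/funext => c; rewrite /bump /= mulrC.
  apply: continuous_comp; last exact: exprn_continuous.
  apply: continuous_comp; last exact: pos_part_continuous.
  apply: differentiable_continuous; apply/derivable1_diffP.
  by have [] := is_derive_bump_arg s 0.
have E : (1 : R) = bump 0 s.
  rewrite /bump mul0r expr0n /= subr0.
  by have [[_ ->]|[a _]] := pos_partP 1; [rewrite expr1n | lra].
have C1 : bump c s @[c --> (0 : R)] --> (1 : R) by rewrite E; exact: C.
exact: (@cvg_comp _ _ _ (@harmonic R) (bump^~ s) _ _ _ cvg_harmonic C1).
Qed.

(** On the support [|c * s| <= 1], so one of the two factors [c] absorbs the unbounded [s]; the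
    other makes the bound vanish with [c]. *)
Lemma bump'_bound c s : 0 <= c -> `|bump' c s| <= 6 * c.
Proof.
move=> c0; rewrite /bump'.
have [[a ->]|[a ->]] := pos_partP (1 - (c * s) ^+ 2); last first.
  by rewrite expr0n /= mulr0 normr0 mulr_ge0.
have cs1 : `|c * s| <= 1.
  by rewrite -(@expr_le1 _ 2)// real_normK ?num_real//; lra.
have -> : - 6 * c ^+ 2 * s * (1 - (c * s) ^+ 2) ^+ 2 =
  (- 6 * c) * ((c * s) * (1 - (c * s) ^+ 2) ^+ 2) by ring.
rewrite normrM mulNr normrN (ger0_norm (_ : 0 <= 6 * c)) ?mulr_ge0//.
rewrite ler_piMr ?mulr_ge0// normrM mulr_ile1// ger0_norm ?sqr_ge0//.
by rewrite exprn_ile1// lerBlDr lerDl sqr_ge0.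
Qed.

(** The constant is [6 + 24]: with [y = (c * s) ^+ 2], both [(1 - y) ^+ 2] and [y * (1 - y)] lie in
    [[0, 1]] on the support. *)
Lemma bump''_bound c s : `|bump'' c s| <= 30 * c ^+ 2.
Proof.
rewrite /bump'' ler_norml.
have := sqr_ge0 c.
have -> : 24 * c ^+ 4 * s ^+ 2 * pos_part (1 - (c * s) ^+ 2) =
  24 * c ^+ 2 * ((c * s) ^+ 2 * pos_part (1 - (c * s) ^+ 2)) by ring.
have := sqr_ge0 (c * s).
move: (c ^+ 2) ((c * s) ^+ 2) => C y y0 C0.
have [[a ->]|[a ->]] := pos_partP (1 - y); last first.
  by rewrite expr0n /= !mulr0 addr0 oppr_le0 mulr_ge0.
have p1 : (1 - y) ^+ 2 <= 1 by nra.
have p2 : y * (1 - y) <= 1 by nra.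
have p3 := sqr_ge0 (1 - y).
have p4 : 0 <= y * (1 - y) by nra.
move: ((1 - y) ^+ 2) (y * (1 - y)) p1 p2 p3 p4 => p q *.
by apply/andP; split; nra.
Qed.

End cutoff.

(** * Cosines with a phase *)

Section cosine.
Context {R : realType}.
Implicit Types th u : R.

(** The phase treats cosine and sine together, and differentiation merely shifts it by [pi / 2]. *)
Definition cosine th u : R := cos (u + th).

Lemma is_derive_cosine th u : is_derive u 1 (cosine th) (cosine (th + pi / 2) u).
Proof.
have H := @is_derive1_comp _ cos (id + cst th) u _ _ (is_derive_cos _)
  (is_deriveD (is_derive_id u (1 : R)) (is_derive_cst th u (1 : R))).
by apply: (is_derive_eq H); rewrite addr0 mulr1 /cosine addrA cosDpihalf.
Qed.

Lemma cosineDpi th u : cosine (th + pi / 2 + pi / 2) u = - cosine th u.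
Proof. by rewrite /cosine !addrA cosDpihalf sinDpihalf. Qed.

Lemma cosine_bound th u : `|cosine th u| <= 1.
Proof. exact: cos_max. Qed.

Lemma cosine_continuous th : continuous (cosine th).
Proof.
move=> u; apply: differentiable_continuous; apply/derivable1_diffP.
by have [] := is_derive_cosine th u.
Qed.

Lemma cosD2piz (u : R) (m : int) : cos (u + 2 * pi * m%:~R) = cos u.
Proof.
have P n (a : R) : cos (a + 2 * pi * n%:R) = cos a.
  rewrite -[RHS](periodicn (@cosD2pi R) n).
  by have -> : 2 * pi * n%:R = pi *+ 2 *+ n :> R by rewrite mulr_natr mulr_natl.
case: m => n; first exact: P.
rewrite NegzE mulrNz -[LHS](P n.+1).
by have -> : u + 2 * pi * - n.+1%:~R + 2 * pi * n.+1%:R = u by rewrite mulrN subrK.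
Qed.

End cosine.

(** * Damped trigonometric sums and their partial derivatives *)

Section waves.
Context {R : realType} {N : nat}.
Implicit Types (x v : 'rV[R]_N) (S : {set 'I_N}) (th c u : R).

Local Notation full := (@finset.setTfor 'I_N).

(** The phase of a monomial: the product of [e^(i x_j)] over [S] is [e^(i (setsum S x))]. *)
Definition setsum S x : R := \sum_(j in S) x 0 j.

Lemma setsumD S x v : setsum S (x + v) = setsum S x + setsum S v.
Proof. by rewrite -big_split; apply: eq_bigr => j _; rewrite mxE. Qed.

Lemma setsumZ S a x : setsum S (a *: x) = a * setsum S x.
Proof. by rewrite mulr_sumr; apply: eq_bigr => j _; rewrite mxE. Qed.

Lemma setsum_delta S j : setsum S (delta_mx 0 j) = (j \in S)%:R.
Proof.
rewrite /setsum big_mkcond (bigD1 j)//= big1 ?addr0 => [|i /negPf ij].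
  by rewrite mxE !eqxx; case: ifP.
by rewrite mxE eqxx ij; case: ifP.
Qed.

Lemma setsum_perm (s : 'S_N) S x : setsum (s @^-1: S) (col_perm s x) = setsum S x.
Proof.
rewrite /setsum [RHS](reindex_perm s) /=.
by apply: eq_big => [i|i _]; rewrite ?inE// mxE.
Qed.

Lemma setsum_tperm S (j m : 'I_N) x : j \in S -> m \notin S ->
  setsum (tperm j m @^-1: S) x = setsum S x - x 0 j + x 0 m.
Proof.
move=> jS mS.
rewrite /setsum (reindex_perm (tperm j m)) /=.
under eq_bigl do rewrite inE tpermK.
rewrite (bigD1 j)//= [\sum_(i in S) x 0 i](bigD1 j)//= tpermL.
rewrite [_ + _ - _]addrAC subrr add0r addrC; congr (_ + _).
apply: eq_bigr => i /andP[iS ij]; rewrite tpermD 1?eq_sym//.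
by apply: contraNneq mS => <-.
Qed.

Lemma setsum_continuous S : continuous (setsum S).
Proof.
by apply: (@continuous_big _ _ _ _ _ add_continuous) => j _; exact: coord_continuous.
Qed.

(** Along a line [setsum S] is affine, so the directional derivative reduces to the chain rule in
    one real variable. *)
Lemma is_derive_setsum_comp S (h : R -> R) x v dh :
  is_derive (setsum S x) 1 h dh -> is_derive x v (h \o setsum S) (dh * setsum S v).
Proof.
move=> H.
have E : (fun t => (h \o setsum S) (t *: v + x)) =
         h \o (setsum S v *: id + cst (setsum S x)).
  by apply/funext => t; rewrite /= setsumD setsumZ !fctE /GRing.scale /= mulrC.
have D : is_derive (0 : R) 1 (h \o (setsum S v *: id + cst (setsum S x))) (dh * setsum S v).
  have H' : is_derive ((setsum S v *: id + cst (setsum S x)) (0 : R)) 1 h dh.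
    by rewrite !fctE scaler0 add0r.
  have G := is_deriveD (is_deriveZ (setsum S v) (is_derive_id (0 : R) 1))
    (is_derive_cst (setsum S x) (0 : R) 1).
  apply: (is_derive_eq (@is_derive1_comp _ _ _ _ _ _ H' G)).
  by rewrite addr0 /GRing.scale /= mulr1.
have [D1 D2] := D.
have Dv : 'D_v (h \o setsum S) x = dh * setsum S v.
  rewrite -D2 -E /derive.
  set g1 := fun h => h^-1 *: _; set g2 := fun h => h^-1 *: _.
  suff -> : g1 = g2 by [].
  by apply/funext => t; rewrite /g1 /g2 /=; rewrite addr0 scale0r add0r [_%:A]mulr1.
apply: (DeriveDef _ Dv); by apply: (proj2 (derivable1P _ _ _)); rewrite E.
Qed.

Lemma is_derive_bigsum (I : finType) (P : pred I) (h : I -> 'rV[R]_N -> R) dh x v :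
  (forall i, is_derive x v (h i) (dh i)) ->
  is_derive x v (fun y => \sum_(i | P i) h i y) (\sum_(i | P i) dh i).
Proof.
move=> H.
have -> : (fun y => \sum_(i | P i) h i y) = \sum_(i | P i) h i.
  by apply/funext => y; rewrite fct_sumE.
by elim/big_ind2 : _ => // [|] *; [exact: is_derive_cst|exact: is_deriveD].
Qed.

(** Leaving [phi] and [psi] general lets one continuity lemma and one derivative lemma serve
    [damped_sym] and its partial derivatives. *)
Definition wave (phi psi : R -> R) S x : R := phi (setsum full x) * psi (setsum S x).

Lemma wave_continuous phi psi S :
  continuous phi -> continuous psi -> continuous (wave phi psi S).
Proof.
move=> cphi cpsi x.
have H1 : {for x, continuous (phi \o setsum full)}.
  by apply: continuous_comp; [exact: setsum_continuous | exact: cphi].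
have H2 : {for x, continuous (psi \o setsum S)}.
  by apply: continuous_comp; [exact: setsum_continuous | exact: cpsi].
exact: (cvgM H1 H2).
Qed.

Lemma is_derive_wave phi phi' psi psi' S j x :
  (forall u, is_derive u 1 phi (phi' u)) -> (forall u, is_derive u 1 psi (psi' u)) ->
  is_derive x (delta_mx 0 j) (wave phi psi S)
    (wave phi' psi S x + (j \in S)%:R * wave phi psi' S x).
Proof.
move=> dphi dpsi.
have H1 := is_derive_setsum_comp (delta_mx 0 j) (dphi (setsum full x)).
have H2 := is_derive_setsum_comp (delta_mx 0 j) (dpsi (setsum S x)).
apply: (is_derive_eq (is_deriveM H1 H2)).
by rewrite !setsum_delta inE /wave /GRing.scale /=; ring.
Qed.

(* With [th = 0] or [- pi / 2], the real or imaginary part of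
   [e_l (e^(i x))], damped along the noncompact direction [(1, .., 1)]. *)
Definition damped_sym c l th x : R :=
  \sum_(S : {set 'I_N} | #|S| == l) wave (bump c) (cosine th) S x.

Lemma is_derive_damped_sym c l th j x :
  is_derive x (delta_mx 0 j) (damped_sym c l th)
   (\sum_(S : {set 'I_N} | #|S| == l) (wave (bump' c) (cosine th) S x +
     (j \in S)%:R * wave (bump c) (cosine (th + pi / 2)) S x)).
Proof.
by apply: is_derive_bigsum => S; apply: is_derive_wave => u;
  [exact: is_derive_bump | exact: is_derive_cosine].
Qed.

Lemma partial_damped_sym c l th j : partial j (damped_sym c l th) =
  fun x => \sum_(S : {set 'I_N} | #|S| == l) (wave (bump' c) (cosine th) S x +
     (j \in S)%:R * wave (bump c) (cosine (th + pi / 2)) S x).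
Proof. by apply/funext => x; have [_] := is_derive_damped_sym c l th j x. Qed.

Definition damped_sym2 c l th i j x : R :=
  \sum_(S : {set 'I_N} | #|S| == l) (wave (bump'' c) (cosine th) S x +
     ((i \in S)%:R + (j \in S)%:R) * wave (bump' c) (cosine (th + pi / 2)) S x
     - (i \in S)%:R * (j \in S)%:R * wave (bump c) (cosine th) S x).

Lemma is_derive_partial_damped_sym c l th i j x :
  is_derive x (delta_mx 0 i) (partial j (damped_sym c l th)) (damped_sym2 c l th i j x).
Proof.
rewrite partial_damped_sym; apply: is_derive_bigsum => S.
have H1 := @is_derive_wave _ _ _ _ S i x (is_derive_bump' c) (is_derive_cosine th).
have H2 := @is_derive_wave _ _ _ _ S i x (is_derive_bump c) (is_derive_cosine (th + pi / 2)).
apply: (is_derive_eq (is_deriveD H1 (is_deriveZ (j \in S)%:R H2))).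
by rewrite /GRing.scale /= /wave cosineDpi; ring.
Qed.

Lemma partial2_damped_sym c l th i j :
  partial i (partial j (damped_sym c l th)) = damped_sym2 c l th i j.
Proof. by apply/funext => x; have [_] := is_derive_partial_damped_sym c l th i j x. Qed.

Lemma damped_sym_continuous c l th : continuous (damped_sym c l th).
Proof.
apply: (@continuous_big _ _ _ _ _ add_continuous) => S _.
by apply: wave_continuous; [exact: bump_continuous | exact: cosine_continuous].
Qed.

Lemma damped_sym_C2 c l th : C2 (damped_sym c l th).
Proof.
split.
- exact: damped_sym_continuous.
- by move=> j x; have [] := is_derive_damped_sym c l th j x.
- move=> j; rewrite partial_damped_sym.
  apply: (@continuous_big _ _ _ _ _ add_continuous) => S _ x.
  have W1 := @wave_continuous _ _ S (@bump'_continuous R c) (@cosine_continuous R th) x.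
  have W2 := @wave_continuous _ _ S (@bump_continuous R c) (@cosine_continuous R (th + pi / 2)) x.
  exact: (cvgD W1 (cvgM (cvg_cst _) W2)).
- by move=> i j x; have [] := is_derive_partial_damped_sym c l th i j x.
- move=> i j; rewrite partial2_damped_sym.
  apply: (@continuous_big _ _ _ _ _ add_continuous) => S _ x.
  have W1 := @wave_continuous _ _ S (@bump''_continuous R c) (@cosine_continuous R th) x.
  have W2 := @wave_continuous _ _ S (@bump'_continuous R c) (@cosine_continuous R (th + pi / 2)) x.
  have W3 := @wave_continuous _ _ S (@bump_continuous R c) (@cosine_continuous R th) x.
  exact: (cvgB (cvgD W1 (cvgM (cvg_cst _) W2)) (cvgM (cvg_cst _) W3)).
Qed.

End waves.

(** * Invariance, support, and the eigenvalue equation up to an error *)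

Section damped_sym_generator.
Context {R : realType} {N : nat}.
Implicit Types (x v : 'rV[R]_N) (S : {set 'I_N}) (th c u : R).

Lemma sum_mem S : \sum_j (j \in S)%:R = #|S|%:R :> R.
Proof.
rewrite -natr_sum -sum1_card [in RHS]big_mkcond /=.
by congr (_%:R); apply: eq_bigr => j _; case: ifP.
Qed.

Lemma sum_notin S : \sum_j (j \notin S)%:R = N%:R - #|S|%:R :> R.
Proof.
rewrite -sum_mem -[in N%:R](card_ord N) -sum1_card natr_sum -sumrB.
by apply: eq_bigr => j _; case: (j \in S); rewrite ?subrr ?subr0.
Qed.

Lemma perm_preim_inj (s : 'S_N) : injective (fun S => s @^-1: S).
Proof.
apply: (can_inj (g := fun S => (s^-1)%g @^-1: S)) => S.
by apply/setP => i; rewrite !inE permKV.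
Qed.

Lemma card_perm_preim (s : 'S_N) S : #|s @^-1: S| = #|S|.
Proof. by rewrite card_preimset//; exact: perm_inj. Qed.

(** A permutation permutes the sets of size [l]. A translation moves each [setsum S] by an integer
    multiple of [2 * pi], invisible to the cosine, and leaves the full sum in the bump fixed because
    the [m j] sum to zero. *)
Lemma damped_sym_invariant c l th : affine_weyl_invariant (@damped_sym R N c l th).
Proof.
move=> s m x m0.
have E S : setsum (s @^-1: S) (col_perm s x + \row_j (2 * pi * (m j)%:~R)) =
    setsum S x + 2 * pi * (\sum_(j in s @^-1: S) m j)%:~R.
  rewrite setsumD setsum_perm; congr (_ + _).
  rewrite rmorph_sum mulr_sumr; apply: eq_bigr => j _; by rewrite mxE.
rewrite /damped_sym (reindex_inj (@perm_preim_inj s)) /=.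
apply: eq_big => [S|S _]; first by rewrite card_perm_preim.
rewrite /wave /cosine E addrAC cosD2piz; congr (bump c _ * _).
have {1}-> : @finset.setTfor 'I_N = s @^-1: (@finset.setTfor 'I_N).
  by apply/setP => i; rewrite !inE.
rewrite E [X in 2 * pi * X%:~R](_ : _ = 0) ?mulr0 ?addr0//.
by rewrite -[RHS]m0; apply: eq_bigl => j; rewrite !inE.
Qed.

Lemma chamber_dist x i j : chamber x -> x 0 i <= x 0 j + 2 * pi.
Proof.
move=> Cx; have p0 := pi_ge0 R.
by have [/Cx/andP[a b]|/ltnW/Cx/andP[a b]] := leqP i j; lra.
Qed.

(** Coordinates in the chamber differ by at most [2 * pi]. Once one of them leaves [[- M, M]], all
    have the same sign and modulus at least [c^-1], so the bump at their sum vanishes. *)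
Lemma damped_sym_compact_support c l th : 0 < c ->
  exists K, compact K /\ forall x, chamber x -> ~ K x -> @damped_sym R N c l th x = 0.
Proof.
move=> c0; pose M : R := c^-1 + 2 * pi.
exists [set x : 'rV[R]_N | forall i, `[- M, M]%classic (x ord0 i)]; split.
  apply: (@rV_compact _ _ (fun=> `[- M, M]%classic)) => i.
  exact: segment_compact.
move=> x Cx /existsNP[i /= Ki].
rewrite /damped_sym big1// => S _; rewrite /wave bump_eq0 ?mul0r//.
rewrite normrM (gtr0_norm c0) -ler_pdivrMl// mulr1.
have N1 : 1 <= N%:R :> R by rewrite ler1n (leq_trans _ (ltn_ord i)).
have ic0 : 0 < c^-1 by rewrite invr_gt0.
have cN : c^-1 <= \sum_(j in @finset.setTfor 'I_N) c^-1.
  by rewrite sumr_const cardsT card_ord -mulr_natr ler_peMr// ltW.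
have [h|h] := ltP M (x 0 i).
  rewrite (le_trans _ (ler_norm _))// (le_trans cN)//.
  apply: ler_sum => j _; have := chamber_dist i j Cx.
  by rewrite /M in h; lra.
have {}h : x 0 i < - M.
  by rewrite ltNge; apply/negP => h'; apply: Ki; rewrite in_itv /= h'.
rewrite -normrN (le_trans _ (ler_norm _))// (le_trans cN)// /setsum -sumrN.
apply: ler_sum => j _; have := chamber_dist j i Cx.
by rewrite /M in h; lra.
Qed.

Lemma cotN u : cot (- u) = - cot u.
Proof. by rewrite /cot cosN sinN invrN mulrN. Qed.

(** Swapping the summation indices negates the sum. Applied to the odd [cot], this removes the drift
    acting on the bump. *)
Lemma antisym_sum0 (K : 'I_N -> 'I_N -> R) (a : R) :
  (forall j m, K m j = - K j m) -> \sum_j \sum_(m | m != j) K j m * a = 0.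
Proof.
move=> Kanti.
set A := LHS.
have : A = - A.
  rewrite [in RHS]/A; under [in RHS]eq_bigr do rewrite big_mkcond /=.
  rewrite exchange_big -sumrN; apply: eq_bigr => j _.
  rewrite -sumrN big_mkcond; apply: eq_bigr => m _.
  by rewrite eq_sym; case: ifP; rewrite ?oppr0// Kanti mulNr.
lra.
Qed.

Definition regular x := forall j m : 'I_N, j != m -> sin ((x 0 j - x 0 m) / 2) != 0.

Lemma open_chamber_regular x : open_chamber x -> regular x.
Proof.
move=> Ox.
have P (j m : 'I_N) : (j < m)%N -> 0 < sin ((x 0 m - x 0 j) / 2).
  by move=> /Ox/andP[a b]; apply: sin_gt0_pi; apply/andP; split; lra.
move=> j m; rewrite neq_ltn => /orP[/P h|/P h]; last by rewrite gt_eqF.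
have -> : (x 0 j - x 0 m) / 2 = - ((x 0 m - x 0 j) / 2) by ring.
by rewrite sinN oppr_eq0 gt_eqF.
Qed.

(** The two phases are [mid + d] and [mid - d]. The difference of their sines has a factor [sin d],
    which cancels the denominator of [cot d]. *)
Lemma cot_exchange (a b th : R) : sin ((a - b) / 2) != 0 -> forall u,
  cot ((a - b) / 2) * (cosine (th + pi / 2) u - cosine (th + pi / 2) (u - a + b)) =
  - (cosine th u + cosine th (u - a + b)).
Proof.
move=> s0 u; rewrite /cosine !addrA !cosDpihalf /cot.
set d := (a - b) / 2 in s0 *.
pose mid := u + th - d.
have -> : u + th = mid + d by rewrite /mid subrK.
have -> : u - a + b + th = mid - d by rewrite /mid /d; field.
rewrite !sinD !cosD sinN cosN; field.
exact: s0.
Qed.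

(* Exchanging [j] and [m] in [S] pairs the terms of the singular drift. *)
Lemma cot_drift l th x : regular x ->
  \sum_j \sum_(m | m != j) cot ((x 0 j - x 0 m) / 2) *
     (\sum_(S : {set 'I_N} | #|S| == l) (j \in S)%:R * cosine (th + pi / 2) (setsum S x)) =
  - (l%:R * (N%:R - l%:R)) * \sum_(S : {set 'I_N} | #|S| == l) cosine th (setsum S x).
Proof.
move=> reg.
pose K (j m : 'I_N) := cot ((x 0 j - x 0 m) / 2).
pose g S := cosine (th + pi / 2) (setsum S x).
pose h S := cosine th (setsum S x).
pose T j := \sum_(S : {set 'I_N} | #|S| == l) (j \in S)%:R * g S.
pose e (j m : 'I_N) S : R := (j \in S)%:R * (m \notin S)%:R.
have Kanti j m : K m j = - K j m by rewrite /K -cotN; congr cot; ring.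
have tau_reindex (j m : 'I_N) (F : {set 'I_N} -> R) :
    \sum_(S : {set 'I_N} | #|S| == l) F S =
    \sum_(S : {set 'I_N} | #|S| == l) F (tperm j m @^-1: S).
  rewrite (reindex_inj (@perm_preim_inj (tperm j m))) /=.
  by apply: eq_bigl => S; rewrite card_perm_preim.
have step j m : K j m * (T j - T m) =
    - \sum_(S : {set 'I_N} | #|S| == l) (e j m S + e m j S) * h S.
  have [->|jm] := eqVneq j m.
    rewrite subrr mulr0 big1 ?oppr0// => S _.
    by rewrite /e; case: (_ \in S); rewrite /= ?(mul0r, mulr0) addr0 mul0r.
  (* After the exchange both sums run over the sets containing [j]. Those that also contain [m] are
     fixed by the exchange and cancel; [cot_exchange] treats the others. *)
  rewrite [T m](tau_reindex j m) /T -sumrB mulr_sumr.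
  transitivity (\sum_(S : {set 'I_N} | #|S| == l)
      (- (e j m S * h S) - e j m S * h (tperm j m @^-1: S))).
    apply: eq_bigr => S _; rewrite !inE tpermR /e.
    case jS : (j \in S); last by rewrite /= mulr0n; ring.
    case mS : (m \in S) => /=.
      have -> : tperm j m @^-1: S = S.
        by apply/setP => i; rewrite inE; case: tpermP => [->|->|]; rewrite ?jS ?mS.
      by rewrite mulr1n mulr0n; ring.
    rewrite mulr1n !mul1r /g /h setsum_tperm// ?mS//.
    by rewrite [LHS]cot_exchange ?reg// opprD.
  rewrite sumrB sumrN -opprD; congr (- _).
  (* Reindexing the second half as well brings it back to [h S], with [j] and [m] swapped in [e]. *)
  rewrite [X in _ + X](tau_reindex j m) -big_split; apply: eq_bigr => S _ /=.
  have -> : tperm j m @^-1: (tperm j m @^-1: S) = S.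
    by apply/setP => i; rewrite !inE tpermK.
  by rewrite mulrDl /e !inE tpermL tpermR.
set A := LHS.
have A1 : A = \sum_j \sum_m K j m * T j.
  apply: eq_bigr => j _; rewrite big_mkcond; apply: eq_bigr => m _.
  case: eqVneq => //= ->.
  (* The diagonal can be included because [0^-1 = 0] makes [cot 0 = 0]. *)
  by rewrite /K subrr mul0r /cot sin0 invr0 mulr0 mul0r.
have A2 : A = - \sum_j \sum_m K j m * T m.
  rewrite A1 exchange_big -sumrN; apply: eq_bigr => j _.
  by rewrite -sumrN; apply: eq_bigr => m _; rewrite Kanti mulNr.
have A3 : A + A = \sum_j \sum_m K j m * (T j - T m).
  rewrite {1}A1 {1}A2 -sumrB; apply: eq_bigr => j _.
  by rewrite -sumrB; apply: eq_bigr => m _; rewrite mulrBr.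
(* There are [l * (N - l)] pairs with [j] inside and [m] outside [S]; the factor 2 counts both
   orders. *)
have cnt S : #|S| == l -> \sum_j \sum_m (e j m S + e m j S) =
    2 * (l%:R * (N%:R - l%:R)).
  move=> /eqP Sl.
  have E : \sum_j \sum_m e j m S = l%:R * (N%:R - l%:R).
    rewrite -Sl -sum_notin -sum_mem mulr_suml; apply: eq_bigr => j _.
    by rewrite mulr_sumr.
  under eq_bigr do rewrite big_split /=.
  rewrite big_split /= E [X in _ + X]exchange_big /=.
  by rewrite [X in _ + X]E; ring.
have : A + A = - (2 * (l%:R * (N%:R - l%:R))) * \sum_(S : {set 'I_N} | #|S| == l) h S.
  rewrite A3; under eq_bigr do under eq_bigr do rewrite step.
  under eq_bigr do rewrite sumrN exchange_big /=.
  rewrite sumrN exchange_big mulNr; congr (- _).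
  rewrite mulr_sumr; apply: eq_bigr => S Sl; rewrite -(cnt S Sl) mulr_suml.
  by apply: eq_bigr => j _; rewrite mulr_suml.
by move=> A4; have -> : A = (A + A) / 2; [field | rewrite A4; field].
Qed.

(** With the bump undifferentiated, the Laplacian contributes [- l / k] and the drift
    [- l * (N - l)], together the eigenvalue. What remains are the Laplacian terms in which the bump
    is differentiated. *)
Lemma Lop_damped_sym k c l th x : regular x ->
  Lop k (@damped_sym R N c l th) x + l%:R * (1 / k + N%:R - l%:R) * damped_sym c l th x =
  k^-1 * \sum_(S : {set 'I_N} | #|S| == l) (N%:R * wave (bump'' c) (cosine th) S x +
    2 * l%:R * wave (bump' c) (cosine (th + pi / 2)) S x).
Proof.
move=> reg; rewrite /Lop.
have -> : \sum_j partial j (partial j (damped_sym c l th)) x =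
  \sum_(S : {set 'I_N} | #|S| == l) (N%:R * wave (bump'' c) (cosine th) S x +
    2 * l%:R * wave (bump' c) (cosine (th + pi / 2)) S x
    - l%:R * wave (bump c) (cosine th) S x).
  under eq_bigr do rewrite partial2_damped_sym.
  rewrite exchange_big; apply: eq_bigr => S /eqP Sl /=.
  rewrite sumrB big_split /= sumr_const card_ord; congr (_ + _ - _).
  - by rewrite mulr_natl.
  - rewrite -mulr_suml -Sl -sum_mem; congr (_ * _).
    by rewrite big_split /=; ring.
  - rewrite -mulr_suml -Sl -sum_mem; congr (_ * _).
    by apply: eq_bigr => j _; case: (j \in S); rewrite ?mulr1 ?mulr0.
have -> : \sum_(j < N) \sum_(m < N | m != j)
    cot ((x 0 j - x 0 m) / 2) * partial j (damped_sym c l th) x =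
  - (l%:R * (N%:R - l%:R)) * damped_sym c l th x.
  (* The derivative of the bump is the same for every [j] and drops out by antisymmetry; the other
     part is the bump times the sum in [cot_drift]. *)
  transitivity (\sum_(j < N) \sum_(m < N | m != j) (cot ((x 0 j - x 0 m) / 2) *
        (\sum_(S : {set 'I_N} | #|S| == l) wave (bump' c) (cosine th) S x) +
      bump c (setsum (@finset.setTfor 'I_N) x) * (cot ((x 0 j - x 0 m) / 2) *
        \sum_(S : {set 'I_N} | #|S| == l) (j \in S)%:R * cosine (th + pi / 2) (setsum S x)))).
    apply: eq_bigr => j _; apply: eq_bigr => m _.
    rewrite partial_damped_sym big_split mulrDr; congr (_ + _).
    rewrite mulrCA; congr (_ * _); rewrite mulr_sumr; apply: eq_bigr => S _.
    by rewrite /wave mulrCA.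
  move: (\sum_(S : {set 'I_N} | _) wave _ _ S x) => W'.
  under eq_bigr do rewrite big_split -mulr_sumr /=.
  rewrite big_split -mulr_sumr /= cot_drift// antisym_sum0 ?add0r; last first.
    by move=> j m; rewrite -cotN; congr cot; ring.
  by rewrite mulrCA; congr (_ * _); rewrite mulr_sumr.
rewrite /damped_sym sumrB -mulr_sumr; ring.
Qed.

(** The constants are those of [bump''_bound] and [bump'_bound], with [12 = 2 * 6]; [c <= 1] reduces
    [c ^+ 2] to [c]. *)
Lemma Lop_damped_sym_bound k c l th x : regular x -> 0 < k -> 0 <= c <= 1 ->
  `|Lop k (@damped_sym R N c l th) x + l%:R * (1 / k + N%:R - l%:R) * damped_sym c l th x|
  <= c * (k^-1 * \sum_(S : {set 'I_N} | #|S| == l) (30 * N%:R + 12 * l%:R)).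
Proof.
move=> reg k0 /andP[c0 c1]; rewrite Lop_damped_sym// normrM.
have ik0 : 0 < k^-1 by rewrite invr_gt0.
rewrite mulrCA (gtr0_norm ik0) ler_pM2l//.
apply: (le_trans (ler_norm_sum _ _ _)); rewrite mulr_sumr.
apply: ler_sum => S _; apply: (le_trans (ler_normD _ _)).
have -> : c * (30 * N%:R + 12 * l%:R) = N%:R * (30 * c) + 2 * l%:R * (6 * c) by ring.
have W (phi psi : R -> R) b : (forall u, `|phi u| <= b) -> (forall u, `|psi u| <= 1) ->
    `|wave phi psi S x| <= b.
  move=> Hphi Hpsi; rewrite /wave normrM.
  by apply: (le_trans _ (Hphi (setsum (@finset.setTfor 'I_N) x))); rewrite ler_piMr.
apply: lerD; rewrite normrM ger0_norm ?mulr_ge0//; apply: ler_wpM2l; rewrite ?mulr_ge0//.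
  apply: W => u; last exact: cosine_bound.
  by apply: (le_trans (bump''_bound c u)); rewrite ler_pM2l// expr2 ler_piMr.
by apply: W => u; [exact: bump'_bound | exact: cosine_bound].
Qed.

End damped_sym_generator.

(** * From approximate eigenfunctions to conditional expectations *)

Section feller_martingale.
Context {R : realType} {d : measure_display} {T : measurableType d}
  (P : probability T R).

Lemma open_preimage_measurable_fun (f : T -> R) :
  (forall U, open U -> measurable (f @^-1` U)) -> measurable_fun setT f.
Proof.
move=> H; apply: (measurability _ (RGenOpens.measurableE R)).
by move=> _ [_ [a [b ->] <-]]; rewrite setTI; apply: H; exact: interval_open.
Qed.

Lemma bounded_integrable A (f : T -> R) B : measurable A ->
  measurable_fun setT f -> (forall w, `|f w| <= B) -> P.-integrable A (EFin \o f).
Proof.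
move=> mA mf fB; apply: measurable_bounded_integrable => //.
- by apply: (le_lt_trans (probability_le1 P mA)); rewrite ltry.
- exact: measurable_funTS.
- by exists B; split; [exact: num_real | move=> M BM w _; apply: le_trans (fB w) (ltW BM)].
Qed.

Lemma Rintegral_norm_bound A (f : T -> R) B : measurable A ->
  measurable_fun setT f -> 0 <= B -> (forall w, `|f w| <= B) ->
  `|\int[P]_(w in A) f w| <= B.
Proof.
move=> mA mf B0 fB; have If := bounded_integrable mA mf fB.
apply: (le_trans (le_normr_Rintegral mA If)).
apply: (@le_trans _ _ (\int[P]_(w in A) (cst B) w)).
  apply: le_Rintegral => //.
    exact: integrable_norm.
  by apply: (@bounded_integrable _ _ B) => // w; rewrite ger0_norm.
rewrite Rintegral_cst// ler_piMr//.
by rewrite -lee_fin fineK ?probability_le1// fin_num_measure.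
Qed.

Lemma Rintegral_bounded_cvg A (F : nat -> T -> R) (f : T -> R) B : measurable A ->
  (forall n, measurable_fun setT (F n)) -> measurable_fun setT f ->
  (forall n w, `|F n w| <= B) -> (forall w, F n w @[n --> \oo] --> f w) ->
  \int[P]_(w in A) F n w @[n --> \oo] --> \int[P]_(w in A) f w.
Proof.
move=> mA mF mf FB Ff.
have fB w : `|f w| <= B.
  have H : `|F n w| @[n --> \oo] --> `|f w| by apply: cvg_norm; exact: Ff.
  by apply: (cvgr_to_le H); apply: nearW => n; exact: FB.
have If := bounded_integrable mA mf fB.
apply: fine_cvg; rewrite fineK; last exact: integrable_fin_num If.
apply: (@dominated_cvg _ _ _ _ _ mA _ _ (cst B%:E)).
- by move=> n; apply/measurable_EFinP; exact: measurable_funTS.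
- by move=> w _; apply: cvg_EFin; [exact: nearW | exact: Ff].
- by [].
- apply: (@bounded_integrable _ (cst B) `|B|) => //.
- by move=> n w _; rewrite /= lee_fin.
Qed.

Lemma natural_filtration_measurable (S : topologicalType) (Y : R -> T -> S) t A :
  (forall s U, 0 <= s -> open U -> measurable (Y s @^-1` U)) ->
  natural_filtration Y t A -> measurable A.
Proof.
move=> mY; suff : natural_filtration Y t `<=` measurable by exact.
apply: smallest_sub; first exact: sigma_algebra_measurable.
by move=> _ [s [U [/andP[s0 _] oU ->]]]; exact: mY.
Qed.

Context {V : topologicalType} (E : set V) (Q : R -> (V -> R) -> V -> R)
  (X : R -> T -> V).
Hypothesis FX : feller_process P E Q X.

(** Preimages of open sets under [f] are only relatively open in [E], but the process never leaves
    [E], so an open set [W] of [V] with the same trace has the same preimage under [X t]. *)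
Lemma process_comp_measurable (f : V -> R) t : 0 <= t ->
  {within E, continuous f} -> measurable_fun setT (f \o X t).
Proof.
move=> t0 /continuousP cf; apply: open_preimage_measurable_fun => U oU.
have /open_subspaceP[W oW WE] := cf U oU.
rewrite (_ : _ @^-1` _ = X t @^-1` W); first exact: (process_measurable FX).
apply/seteqP; split => w /= h; have Ew := process_range FX w t0.
- by have [] : (W `&` E) (X t w) by rewrite WE.
- by have [] : (f @^-1` U `&` E) (X t w) by rewrite -WE.
Qed.

(** The Markov property and [feller_decay] give the identity for [F n] up to an error of order
    [n.+1%:R^-1]; bounded convergence then passes to the limit [f], which may lie outside [C0 E]. *)
Lemma feller_expectation (F : nat -> V -> R) (f : V -> R) lam B C s t A :
  0 <= lam -> {within E, continuous f} ->
  (forall n x, E x -> `|F n x| <= B) ->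
  (forall x, E x -> F n x @[n --> \oo] --> f x) ->
  (forall n, exists2 g, generator E Q (F n) g &
     forall x, E x -> `|g x + lam * F n x| <= n.+1%:R^-1 * C) ->
  0 <= s -> s <= t -> natural_filtration X s A ->
  \int[P]_(w in A) f (X t w) =
  expR (- (lam * (t - s))) * \int[P]_(w in A) f (X s w).
Proof.
move=> lam0 cf FB Ff FG s0 st FA.
have t0 : 0 <= t by exact: le_trans st.
have r0 : 0 <= t - s by rewrite subr_ge0.
have FQ := process_semigroup FX.
have mA : measurable A.
  by apply: natural_filtration_measurable FA => u U; exact: (process_measurable FX).
have CF n : C0 E (F n) by have [g []] := FG n.
have mF n u : 0 <= u -> measurable_fun setT (F n \o X u).
  by move=> u0; apply: process_comp_measurable => //; case: (CF n).
have lim u : 0 <= u ->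
    \int[P]_(w in A) F n (X u w) @[n --> \oo] --> \int[P]_(w in A) f (X u w).
  move=> u0; apply: (@Rintegral_bounded_cvg _ (fun n => F n \o X u) (f \o X u) B) => //.
  - by move=> n; exact: mF.
  - exact: process_comp_measurable.
  - by move=> n w; apply: FB; exact: (process_range FX).
  - by move=> w; apply: Ff; exact: (process_range FX).
set q := expR _.
have bound n : `|\int[P]_(w in A) F n (X t w) - q * \int[P]_(w in A) F n (X s w)|
    <= n.+1%:R^-1 * ((t - s) * C).
  have [g Gg gC] := FG n.
  have dec := feller_decay FQ Gg lam0 (FB n) gC r0.
  have CQ := feller_C0 FQ r0 (CF n).
  have mQ : measurable_fun setT (Q (t - s) (F n) \o X s).
    by apply: process_comp_measurable => //; case: CQ.
  have -> : \int[P]_(w in A) F n (X t w) = \int[P]_(w in A) Q (t - s) (F n) (X s w).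
    by rewrite -(process_markov FX s0 r0 (CF n) FA) addrC subrK.
  have IF : P.-integrable A (EFin \o (F n \o X s)).
    apply: (@bounded_integrable _ _ B) => // [|w]; first exact: mF.
    by apply: FB; exact: (process_range FX).
  have IQ : P.-integrable A (EFin \o (Q (t - s) (F n) \o X s)).
    apply: (@bounded_integrable _ _ B) => // w.
    by apply: (feller_contraction FQ) => //; [exact: FB | exact: (process_range FX)].
  have dec' w : `|Q (t - s) (F n) (X s w) - q * F n (X s w)| <= n.+1%:R^-1 * ((t - s) * C).
    by rewrite mulrCA; apply: dec; exact: (process_range FX).
  rewrite -RintegralZl// -RintegralB//; last first.
    apply: (@bounded_integrable _ (fun w => q * F n (X s w)) (q * B)) => // [|w].
      by apply: measurable_funM => //; exact: mF.
    rewrite normrM ger0_norm ?expR_ge0// ler_wpM2l ?expR_ge0//.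
    by apply: FB; exact: (process_range FX).
  apply: Rintegral_norm_bound => //.
    apply: measurable_funB => //; apply: measurable_funM => //; exact: mF.
  (* The sign of the bound is read off at a sample point, which exists because [P] has total mass
     one. *)
  have [w0|nw0] := pselect (exists w : T, True).
    by case: w0 => w _; apply: le_trans (dec' w).
  exfalso.
  have : P setT = 1%E by exact: probability_setT.
  rewrite (_ : setT = set0); last by apply/seteqP; split => w // _; case: nw0; exists w.
  by rewrite measure0 => /eqP; rewrite eqe eq_sym oner_eq0.
have L1 : \int[P]_(w in A) F n (X t w) - q * \int[P]_(w in A) F n (X s w) @[n --> \oo]
    --> \int[P]_(w in A) f (X t w) - q * \int[P]_(w in A) f (X s w).
  by apply: cvgB; [exact: lim | apply: cvgM; [exact: cvg_cst | exact: lim]].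
have L0 : \int[P]_(w in A) F n (X t w) - q * \int[P]_(w in A) F n (X s w) @[n --> \oo] --> (0 : R).
  apply: norm_cvg0.
  have H : n.+1%:R^-1 * ((t - s) * C) @[n --> \oo] --> (0 : R).
    rewrite -[X in _ --> X](mul0r ((t - s) * C)).
    by apply: cvgM; [exact: cvg_harmonic | exact: cvg_cst].
  apply: (squeeze_cvgr _ (cvg_cst 0) H).
  by apply: nearW => n; rewrite normr_ge0 bound.
apply/eqP; rewrite -subr_eq0; apply/eqP.
exact: (cvg_unique _ L1 L0).
Qed.

End feller_martingale.

(** * Passing from the open chamber to its boundary *)

Section chamber_density.
Context {R : realType} {N : nat}.
Implicit Types (x : 'rV[R]_N).

(** Equally spaced angles within one turn, a reference point of the open chamber. *)
Definition chamber_center : 'rV[R]_N := \row_j (2 * pi * (j%:R / N%:R)).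

(** Averaging the weak inequalities at [x] with the strict ones at the center, the latter with
    weight [t > 0], gives strict ones. *)
Lemma chamber_segment x t : chamber x -> 0 < t <= 1 ->
  open_chamber (x + t *: (chamber_center - x)).
Proof.
move=> Cx /andP[t0 t1] i j ij; rewrite !mxE.
have /andP[h1 h2] := Cx i j (ltnW ij).
have N0 : 0 < N%:R :> R by rewrite ltr0n (leq_ltn_trans _ (ltn_ord j)).
have p0 := pi_gt0 R.
have a0 : 0 <= i%:R / N%:R :> R by rewrite divr_ge0.
have a1 : i%:R / N%:R < j%:R / N%:R :> R by rewrite ltr_pM2r ?invr_gt0// ltr_nat.
have a2 : j%:R / N%:R < 1 :> R by rewrite ltr_pdivrMr// mul1r ltr_nat.
move: (i%:R / N%:R) (j%:R / N%:R) a0 a1 a2 => a b a0 a1 a2.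
have q1 : 0 < pi * (b - a) by rewrite mulr_gt0// subr_gt0.
have q2 : pi * (b - a) < pi by rewrite gtr_pMr//; lra.
have e1 : x 0 j - x 0 i <= 2 * pi by lra.
have e0 : 0 <= x 0 j - x 0 i by lra.
have k1 : 0 <= (1 - t) * (x 0 j - x 0 i) by rewrite mulr_ge0// subr_ge0.
have k2 : (1 - t) * (x 0 j - x 0 i) <= (1 - t) * (2 * pi).
  by rewrite ler_wpM2l// subr_ge0.
have k3 : 0 < t * (pi * (b - a)) by rewrite mulr_gt0.
have k4 : t * (pi * (b - a)) < t * pi by rewrite ltr_pM2l.
by apply/andP; split; lra.
Qed.

(** A boundary point is approached along the segment to the center. This is needed since the
    generator is known to equal [Lop] only inside. *)
Lemma chamber_bound_extend (h : 'rV[R]_N -> R) B :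
  {within chamber, continuous h} -> (forall x, open_chamber x -> `|h x| <= B) ->
  forall x, chamber x -> `|h x| <= B.
Proof.
move=> /subspace_continuousP ch hB x Cx.
pose p t := x + t *: (chamber_center - x).
have px : p t @[t --> 0^'+] --> x.
  have C : {for 0, continuous p}.
    by move=> ?; apply: cvgD; [exact: cvg_cst | apply: cvgZr_tmp; exact: cvg_id].
  have -> : x = p 0 by rewrite /p scale0r addr0.
  exact: cvg_at_right_filter C.
have pin : \forall t \near 0^'+, open_chamber (p t).
  by near=> t; apply: chamber_segment => //; apply/andP; split; near: t;
    [exact: nbhs_right_gt | exact: nbhs_right_le].
have H : h (p t) @[t --> 0^'+] --> h x.
  apply: (cvg_comp _ _ _ (ch x Cx)) => U HU.
  have := px _ HU; rewrite /= => HU'.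
  near=> t.
  have : chamber (p t).
    have op : open_chamber (p t) by near: t.
    move=> i j; rewrite leq_eqVlt => /orP[/eqP ij|/op/andP[a b]].
      have -> : i = j by apply: val_inj.
      by rewrite lexx /= lerDl mulr_ge0// pi_ge0.
    by rewrite !ltW.
  by near: t.
apply: (cvgr_to_le (cvg_norm H)).
near=> t; apply: hB; near: t; exact: pin.
Unshelve. all: by end_near. Qed.

End chamber_density.

(** * Elementary symmetric polynomials on the torus; continuity over [R[i]] *)

Section elementary_symmetric.
Context {R : realType} {N : nat}.
Implicit Types (x : 'rV[R]_N) (z : 'rV[R[i]]_N).

Definition trig_sym (l : nat) (th : R) x : R :=
  \sum_(S : {set 'I_N} | #|S| == l) cosine th (setsum S x).

Lemma elem_symE l z :
  elem_sym l z = \sum_(S : {set 'I_N} | #|S| == l) \prod_(j in S) z 0 j.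
Proof.
rewrite /elem_sym /mpoly.mesym.
rewrite (big_morph _ (mpoly.mevalD (z 0)) (mpoly.meval0 (z 0))).
apply: eq_bigr => S _.
rewrite (big_morph _ (mpoly.mevalM (z 0)) (mpoly.meval1 (z 0))).
by apply: eq_bigr => j _; rewrite mpoly.mevalXU.
Qed.

Lemma prod_expi (S : {set 'I_N}) x :
  \prod_(j in S) expi x 0 j = cos (setsum S x) +i* sin (setsum S x).
Proof.
rewrite /setsum; elim/big_rec2 : _ => [|j y1 y2 _ ->].
  by rewrite cos0 sin0.
rewrite mxE cosD sinD; apply/eqP; rewrite eq_complex /=.
by rewrite eqxx addrC eqxx.
Qed.

Lemma elem_sym_expi l x :
  elem_sym l (expi x) = trig_sym l 0 x +i* trig_sym l (- (pi / 2)) x.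
Proof.
rewrite elem_symE /trig_sym; elim/big_rec3 : _ => // S a b y _ ->.
rewrite prod_expi /cosine addr0 cosBpihalf.
by apply/eqP; rewrite eq_complex /= !eqxx.
Qed.

Lemma sum_prod_continuous (K : numFieldType) l :
  continuous (fun z : 'rV[K]_N => \sum_(S : {set 'I_N} | #|S| == l) \prod_(j in S) z 0 j).
Proof.
apply: (@continuous_big _ _ _ _ _ add_continuous) => S _.
apply: (@continuous_big _ _ _ _ _ mul_continuous) => j _.
exact: coord_continuous.
Qed.

Lemma elem_sym_continuous l :
  continuous (@elem_sym R N l : 'rV[(R[i] : numFieldType)]_N -> (R[i] : numFieldType)).
Proof.
rewrite (_ : @elem_sym R N l = fun z => \sum_(S : {set 'I_N} | #|S| == l) \prod_(j in S) z 0 j).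
  exact: (@sum_prod_continuous (R[i] : numFieldType) l).
by apply/funext => z; exact: elem_symE.
Qed.

Lemma complex_cvg (S : topologicalType) (a b : S -> R) s :
  {for s, continuous a} -> {for s, continuous b} ->
  {for s, continuous ((fun y => a y +i* b y) : S -> (R[i] : numFieldType))}.
Proof.
move=> ca cb; apply/cvgrPdist_lt => e.
(* A positive element of [R[i]] is real, so [complex.Re e] is the radius; each component gets half
   of it. *)
rewrite ltcE /= => /andP[/eqP e0 er].
have er2 : 0 < complex.Re e / 2 by rewrite divr_gt0.
have /cvgrPdist_lt/(_ _ er2) Ha := ca.
have /cvgrPdist_lt/(_ _ er2) Hb := cb.
near=> y.
have Ha' : `|a s - a y| < complex.Re e / 2 by near: y.
have Hb' : `|b s - b y| < complex.Re e / 2 by near: y.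
rewrite normc_def ltcE /= -e0 eqxx /=.
apply: (@le_lt_trans _ _ (`|a s - a y| + `|b s - b y|)); last by lra.
rewrite -[leRHS]ger0_norm ?addr_ge0// -sqrtr_sqr ler_wsqrtr//.
rewrite -[(_ - _) ^+ 2]real_normK ?num_real// -[X in _ + X]real_normK ?num_real//.
rewrite sqrrD -addrA lerD2l lerDr mulrn_wge0// mulr_ge0//.
Unshelve. all: by end_near. Qed.

(** Neighbourhoods of a row vector are given entrywise, and the finitely many conditions hold
    simultaneously near [x]. *)
Lemma expi_continuous :
  continuous (@expi R N : 'rV[R]_N -> 'rV[(R[i] : numFieldType)]_N).
Proof.
move=> x U [W HW WU].
have H i j : \forall y \near x, W i j (expi y i j).
  have C : {for x, continuous (fun y => expi y i j : (R[i] : numFieldType))}.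
    have -> : (fun y : 'rV[R]_N => expi y i j) = fun y => cos (y 0 j) +i* sin (y 0 j).
      by apply/funext => y; rewrite mxE.
    have Cc : {for x, continuous (cos \o (fun y : 'rV[R]_N => y 0 j))}.
      by apply: continuous_comp; [exact: coord_continuous | exact: continuous_cos].
    have Cs : {for x, continuous (sin \o (fun y : 'rV[R]_N => y 0 j))}.
      by apply: continuous_comp; [exact: coord_continuous | exact: continuous_sin].
    exact: complex_cvg Cc Cs.
  exact: C (HW i j).
pose f (ij : 'I_1 * 'I_N) (y : 'rV[R]_N) := W ij.1 ij.2 (expi y ij.1 ij.2).
have : \forall y \near x, forall ij, f ij y.
  exact: (@filter_forall _ _ f (nbhs x) _ (fun ij => H ij.1 ij.2)).
apply: filterS => y Hy; apply: WU => i j; exact: (Hy (i, j)).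
Qed.

End elementary_symmetric.

(** * Conditional expectations of the real and imaginary parts *)

Section trig_sym_expectation.
Context {R : realType} {N : nat}.

Lemma trig_sym_continuous l th : continuous (@trig_sym R N l th).
Proof.
apply: (@continuous_big _ _ _ _ _ add_continuous) => S _ x.
by apply: (@continuous_comp _ _ _ (setsum S) (cosine th));
  [exact: setsum_continuous | exact: cosine_continuous].
Qed.

Lemma trig_sym_bound l th (x : 'rV[R]_N) :
  `|trig_sym l th x| <= \sum_(S : {set 'I_N} | #|S| == l) 1.
Proof.
by apply: (le_trans (ler_norm_sum _ _ _)); apply: ler_sum => S _; exact: cosine_bound.
Qed.

Lemma damped_symE c l th (x : 'rV[R]_N) :
  damped_sym c l th x = bump c (setsum (@finset.setTfor 'I_N) x) * trig_sym l th x.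
Proof. by rewrite mulr_sumr. Qed.

Context {d : measure_display} {T : measurableType d} (P : probability T R).

(** The approximants are damped with parameter [n.+1%:R^-1], and [l <= N] makes the decay rate
    nonnegative. *)
Lemma trig_sym_expectation k (X : R -> T -> 'rV[R]_N) l th s t A :
  0 < k -> (l <= N)%N -> reflected_diffusion P k X -> 0 <= s -> s <= t ->
  natural_filtration X s A ->
  \int[P]_(w in A) trig_sym l th (X t w) =
  expR (- (l%:R * (1 / k + N%:R - l%:R) * (t - s))) *
    \int[P]_(w in A) trig_sym l th (X s w).
Proof.
move=> k0 lN [Q [FX HQ]].
pose C : R := k^-1 * \sum_(S : {set 'I_N} | #|S| == l) (30 * N%:R + 12 * l%:R).
apply: (feller_expectation (F := fun n => damped_sym n.+1%:R^-1 l th)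
  (B := \sum_(S : {set 'I_N} | #|S| == l) 1) (C := C) FX).
- rewrite mulr_ge0// -addrA addr_ge0//; first by rewrite div1r invr_ge0 ltW.
  by rewrite subr_ge0 ler_nat.
- by apply: continuous_subspaceT => x; exact: trig_sym_continuous.
- move=> n x _; rewrite damped_symE normrM (ger0_norm (bump_ge0 _ _)).
  by apply: (le_trans _ (trig_sym_bound l th x)); rewrite ler_piMl// bump_le1.
- move=> x _; under eq_cvg do rewrite damped_symE.
  have H : bump n.+1%:R^-1 (setsum (@finset.setTfor 'I_N) x) * trig_sym l th x
      @[n --> \oo] --> 1 * trig_sym l th x.
    by apply: cvgM; [exact: bump0_cvg | exact: cvg_cst].
  by rewrite mul1r in H.
move=> n; have c0 : 0 < n.+1%:R^-1 :> R by rewrite invr_gt0.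
have c1 : n.+1%:R^-1 <= 1 :> R by rewrite invf_le1// ler1n.
have [g Gg gL] := HQ _ (@damped_sym_C2 R N n.+1%:R^-1 l th)
  (@damped_sym_invariant R N n.+1%:R^-1 l th) (damped_sym_compact_support l th c0).
exists g => //; apply: chamber_bound_extend; last first.
  move=> x Ox; rewrite gL//; apply: Lop_damped_sym_bound => //; last by rewrite ltW.
  exact: open_chamber_regular.
have [_ [cg _] _] := Gg.
move=> x; apply: cvgD; first exact: cg.
apply: cvgM; first exact: cvg_cst.
by apply: continuous_subspaceT => y; exact: damped_sym_continuous.
Qed.

(** Continuity of [expi] turns generating events of the torus process into events of [X], so
    identities over the filtration of [X] carry over. *)
Lemma torus_filtration_sub (X : R -> T -> 'rV[R]_N) t :
  torus_filtration X t `<=` natural_filtration X t.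
Proof.
apply: smallest_sub; first exact: smallest_sigma_algebra.
move=> _ [s [U [st oU ->]]]; apply: sub_sigma_algebra.
exists s, (@expi R N @^-1` U); split => //.
by move/continuousP : (@expi_continuous R N); apply.
Qed.

End trig_sym_expectation.

(** * The martingale property and the mean of the complex-valued process *)

Theorem corollary3p5 (R : realType) (N : nat) (k : R) (z : 'rV[R[i]]_N)
    (d : measure_display) (T : measurableType d) (P : probability T R)
    (X : R -> T -> 'rV[R]_N) (l : nat) :
  (2 <= N)%N -> 0 < k -> torus_chamber z ->
  reflected_diffusion P k X -> starts_in X z ->
  (l <= N)%N ->
  martingale P (torus_filtration X)
    (fun t w => (expR (l%:R * (1 / k + N%:R - l%:R) * t))%:C *
                elem_sym l (torus_process X t w)) /\
  (forall t, 0 <= t ->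
    cintegral P setT (fun w => elem_sym l (torus_process X t w)) =
      (expR (- (l%:R * (1 / k + N%:R - l%:R) * t)))%:C * elem_sym l z).
Proof.
move=> N2 k0 _ HX [x0 [_ <- X0]] lN.
have [Q [FX _]] := HX.
set lam := l%:R * (1 / k + N%:R - l%:R).
have mX th t : 0 <= t -> measurable_fun setT (trig_sym l th \o X t).
  move=> t0; apply: (process_comp_measurable FX t0).
  by apply: continuous_subspaceT => x; exact: trig_sym_continuous.
have IX th t A : 0 <= t -> measurable A ->
    P.-integrable A (EFin \o (trig_sym l th \o X t)).
  move=> t0 mA; apply: (bounded_integrable P mA (mX th t t0)) => w.
  exact: trig_sym_bound.
have ME t w : (expR (lam * t))%:C * elem_sym l (torus_process X t w) =
    (expR (lam * t) * trig_sym l 0 (X t w)) +i*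
    (expR (lam * t) * trig_sym l (- (pi / 2)) (X t w)).
  rewrite /torus_process elem_sym_expi; apply/eqP.
  by rewrite eq_complex /= !mul0r subr0 addr0 !eqxx.
(* The growth factor at time [t] times the decay over [t - s] is the growth factor at time [s]. *)
have key th s t A : 0 <= s -> s <= t -> torus_filtration X s A ->
    \int[P]_(w in A) (expR (lam * t) * trig_sym l th (X t w)) =
    \int[P]_(w in A) (expR (lam * s) * trig_sym l th (X s w)).
  move=> s0 st FA; have t0 := le_trans s0 st.
  have FA' := torus_filtration_sub FA.
  have mA : measurable A.
    by apply: natural_filtration_measurable FA' => u U; exact: (process_measurable FX).
  rewrite (RintegralZl _ mA (IX th t A t0 mA)) (RintegralZl _ mA (IX th s A s0 mA)).
  rewrite (trig_sym_expectation th k0 lN HX s0 st FA') -/lam mulrA -expRD.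
  by congr (expR _ * _); ring.
split.
  split.
  - move=> t U t0 oU; apply: sub_sigma_algebra.
    pose h (z : 'rV[(R[i] : numFieldType)]_N) : (R[i] : numFieldType) :=
      (expR (lam * t))%:C * elem_sym l z.
    (* At time [t] the process is a continuous function of the torus process at the same time, so
       the preimage of [U] is a generating event. *)
    exists t, (h @^-1` U); split; rewrite ?t0 ?lexx//.
    have ch : continuous h.
      by move=> y; exact: (cvgM (cvg_cst _) (@elem_sym_continuous R N l y)).
    by move/continuousP : ch; apply.
  - move=> t t0; split; under eq_fun do rewrite ME /=.
      exact: (integrableZl measurableT _ (IX 0 t setT t0 measurableT)).
    exact: (integrableZl measurableT _ (IX (- (pi / 2)) t setT t0 measurableT)).
  - move=> s t A s0 st FA; rewrite /cintegral.
    under eq_Rintegral do rewrite ME /=.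
    under [X in _ +i* X = _]eq_Rintegral do rewrite ME /=.
    under [X in _ = X +i* _]eq_Rintegral do rewrite ME /=.
    under [X in _ = _ +i* X]eq_Rintegral do rewrite ME /=.
    by rewrite !(key _ s t A).
move=> t t0.
(* The mean is the identity from time 0 to [t] over the whole space; the deterministic start makes
   its right-hand integrand constant. *)
have F0 : torus_filtration X 0 setT.
  apply: sub_sigma_algebra; exists 0, setT.
  by rewrite lexx preimage_setT; split => //; exact: openT.
have E th : \int[P]_(w in setT) trig_sym l th (X t w) =
    expR (- (lam * t)) * trig_sym l th x0.
  have := trig_sym_expectation th k0 lN HX (lexx 0) t0 (torus_filtration_sub F0).
  rewrite subr0 => ->; congr (_ * _).
  under eq_Rintegral do rewrite X0.
  rewrite Rintegral_cst// [X in fine X](_ : _ = 1%E) ?mulr1//.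
  exact: probability_setT.
rewrite /cintegral.
under eq_Rintegral do rewrite /torus_process elem_sym_expi /=.
under [X in _ +i* X = _]eq_Rintegral do rewrite /torus_process elem_sym_expi /=.
rewrite !E elem_sym_expi; apply/eqP.
by rewrite eq_complex /= !mul0r subr0 addr0 !eqxx.
Qed.
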